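(* For all $d\ge1$ and $1\le j\le d$, the polynomials $B^+_{d,j}(t)$ and $B^-_{d,j}(t)$ are real-rooted.
   Context: $B_d$ is the group of bijections $\sigma$ of $\{\pm1,\ldots,\pm d\}$ with $\sigma_{-i}=-\sigma_i$, written $\sigma=\sigma_1\cdots\sigma_d$. With $\sigma_0=0$, $\mathrm{Des}_B(\sigma)=\{i\in\{0,\ldots,d-1\}:\sigma_i>\sigma_{i+1}\}$ and $\mathrm{des}_B(\sigma)=|\mathrm{Des}_B(\sigma)|$. For $j\in\{\pm1,\ldots,\pm d\}$, $B^+_{d,j}(t)=\sum_{\sigma}t^{\mathrm{des}_B(\sigma)}$, the sum over $\sigma\in B_d$ with $\sigma_1=j$ and $\sigma_d>0$; and $B^-_{d,j}(t)=\sum_{\sigma}t^{\mathrm{des}_B(\sigma)}$, the sum over $\sigma\in B_d$ with $\sigma_1=j$ and $\sigma_d<0$. A real polynomial is real-rooted if all its complex zeros are real; the zero polynomial is regarded as real-rooted. *)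

(* Defs.v *)
From HB Require Import structures.
From mathcomp Require Import all_boot all_order all_algebra all_fingroup.
From mathcomp Require Import complex.
From mathcomp Require Import reals.

Set Implicit Arguments.
Unset Strict Implicit.
Unset Printing Implicit Defensive.

Import Order.TTheory GRing.Theory Num.Theory.
Local Open Scope ring_scope.

Definition pm_seq (d : nat) : seq int :=
  [seq i.+1%:Z | i <- iota 0 d] ++ [seq - i.+1%:Z | i <- iota 0 d].

Lemma mem_pm_seq (d : nat) (x : int) :
  (x \in pm_seq d) = (0 < `|x| <= d)%N.
Proof.
rewrite mem_cat; apply/idP/idP => [/orP[] | /andP[x_gt0 x_led]].
- by case/mapP => i; rewrite mem_iota => lt_id ->.
- by case/mapP => i; rewrite mem_iota => lt_id ->; rewrite abszN.
have hi : `|x|%N.-1 \in iota 0 d by rewrite mem_iota /= prednK.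
case: (lerP 0 x) => hx; apply/orP; [left | right];
  apply/mapP; exists `|x|%N.-1 => //.
  by rewrite prednK // gez0_abs.
by rewrite prednK // ltz0_abs // opprK.
Qed.

(* The finite type {1, ..., d, -1, ..., -d}, a subtype of [int]. *)
Definition pm (d : nat) := seq_sub (pm_seq d).

(* [sapp s i] is sigma_i; it is 0 for every i outside {+-1, ..., +-d}, so in
   particular sigma_0 = 0. *)
Definition sapp (d : nat) (s : {perm pm d}) (i : int) : int :=
  if insub i is Some k then \val (s k) else 0.

Definition B (d : nat) : {set {perm pm d}} :=
  [set s | [forall k : pm d, sapp s (- \val k) == - sapp s (\val k)]].

Definition DesB (d : nat) (s : {perm pm d}) : {set 'I_d} :=
  [set i : 'I_d | sapp s i%:Z > sapp s i.+1%:Z].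

Definition desB (d : nat) (s : {perm pm d}) : nat := #|DesB s|.

Definition Bplus (R : nzRingType) (d : nat) (j : int) : {poly R} :=
  \sum_(s in B d | (sapp s 1 == j) && (0 < sapp s d%:Z)) 'X^(desB s).

Definition Bminus (R : nzRingType) (d : nat) (j : int) : {poly R} :=
  \sum_(s in B d | (sapp s 1 == j) && (sapp s d%:Z < 0)) 'X^(desB s).

Definition real_rooted (R : realType) (p : {poly R}) : Prop :=
  p = 0 \/
  forall z : complex R,
    root (map_poly (real_complex R) p) z -> exists x : R, z = real_complex R x.

(* Main.v *)
Require Import Defs.
From mathcomp Require Import all_boot all_order all_algebra all_fingroup.
From mathcomp Require Import complex.
From mathcomp Require Import reals.
From mathcomp Require Import ring lra zify.

(** Fix a complex number z with Im z > 0; it is enough that the polynomials do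
not vanish at such a z, since their coefficients are real.

Removing the first letter of a signed permutation gives a recurrence.  Work
with signed words over any finite set S of absolute values, and sort the
possible first letters.  The sum of z^des over the words with first letter k
and last letter of a given sign, where only descents between letters count,
depends only on #|S| and on the rank of k, so the values at z form a row
F_0, ..., F_(2n-1) with n = #|S|.  Putting a letter x in front multiplies the
terms whose first letter is below x by z, so each entry of the next row is
  G_i = F_i + ... + F_(2n-1) + z F_0 + ... + z F_(i-1),
where i is the number of letters below x ([wsumE]).

Interlacing becomes a pointwise statement about this row: the numbers
F_0, F_1, ..., F_(2n-1), z F_0 have weakly increasing arguments, turning by at
most arg z < pi in total.  For two numbers a, b this is the relation [turn],
0 <= Im(b conj a) and 0 <= Im(z a conj b), which is additive in a and in b.
Moving F_0 to the end as z F_0 preserves the condition ([pairwise_shift]), and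
G_i is just the sum of the list after i such moves.  Hence comparing G_i with
G_j reduces to comparing b + c with c + z b, where b is the sum of an initial
segment and c the sum of the rest ([turn_split]), and the rows inherit the
condition from each other.  Finally, such a list can only have sum zero when
all its entries vanish ([pairwise_sum_eq0]), so all the G_i are nonzero as soon
as one of the F_i is.  The first row is (0, 1) or (1, 0). *)

Set Implicit Arguments.
Unset Strict Implicit.
Unset Printing Implicit Defensive.

Import Order.TTheory GRing.Theory Num.Theory.
Local Open Scope ring_scope.

(** * Complex numbers ordered by argument *)

Section ArgumentOrder.
Variable R : rcfType.
Implicit Types (a b c z : complex R) (s r : seq (complex R)).

(** This is Im (b * conj a): it is nonnegative when b is reached from a by a
left turn of angle at most pi. *)
Definition cross a b : R :=
  complex.Re a * complex.Im b - complex.Im a * complex.Re b.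

Lemma crossDl a b c : cross (a + b) c = cross a c + cross b c.
Proof. by case: a b c => [? ?] [? ?] [? ?]; rewrite /cross /=; ring. Qed.

Lemma crossDr a b c : cross a (b + c) = cross a b + cross a c.
Proof. by case: a b c => [? ?] [? ?] [? ?]; rewrite /cross /=; ring. Qed.

Lemma cross0l b : cross 0 b = 0.
Proof. by rewrite /cross /=; ring. Qed.

Lemma cross0r a : cross a 0 = 0.
Proof. by rewrite /cross /=; ring. Qed.

Definition sqnorm a : R := complex.Re a ^+ 2 + complex.Im a ^+ 2.

Lemma sqnorm_ge0 a : 0 <= sqnorm a.
Proof. by rewrite addr_ge0 ?sqr_ge0. Qed.

Lemma sqnorm_eq0 a : (sqnorm a == 0) = (a == 0).
Proof.
by case: a => x y; rewrite paddr_eq0 ?sqr_ge0 // !sqrf_eq0 eq_complex.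
Qed.

Lemma cross_mul z a : cross a (z * a) = complex.Im z * sqnorm a.
Proof. by case: a z => [? ?] [? ?]; rewrite /cross /sqnorm /=; ring. Qed.

Lemma crossMM z a b : cross (z * a) (z * b) = sqnorm z * cross a b.
Proof.
by case: a b z => [? ?] [? ?] [? ?]; rewrite /cross /sqnorm /=; ring.
Qed.

Lemma crossvv a : cross a a = 0.
Proof. by rewrite /cross; ring. Qed.

Variable z : complex R.
Hypothesis z_upper : 0 < complex.Im z.

(** The argument of b lies between that of a and that of z * a.  Zero is related
to everything, so rows with vanishing entries need no special treatment. *)
Definition turn a b := (0 <= cross a b) && (0 <= cross b (z * a)).

Lemma turn0l b : turn 0 b.
Proof. by rewrite /turn mulr0 cross0l cross0r lexx. Qed.

Lemma turn0r a : turn a 0.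
Proof. by rewrite /turn cross0l cross0r lexx. Qed.

Lemma turnDl a b c : turn a c -> turn b c -> turn (a + b) c.
Proof.
move=> /andP[ac1 ac2] /andP[bc1 bc2].
by rewrite /turn mulrDr crossDl crossDr; apply/andP; split; apply: addr_ge0.
Qed.

Lemma turnDr a b c : turn a b -> turn a c -> turn a (b + c).
Proof.
move=> /andP[ab1 ab2] /andP[ac1 ac2].
by rewrite /turn crossDl crossDr; apply/andP; split; apply: addr_ge0.
Qed.

Lemma turn_sum s r :
  allrel turn s r -> turn (\sum_(a <- s) a) (\sum_(b <- r) b).
Proof.
move=> /allrelP sr.
rewrite big_seq; elim/big_rec: _ => [|a a' sa]; first by rewrite turn0l.
apply: turnDl; rewrite big_seq.
elim/big_rec: _ => [|b b' rb]; [exact: turn0r | exact/turnDr/sr].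
Qed.

Lemma turn_mul a b : turn a b -> turn b (z * a).
Proof.
move=> /andP[ab1 ab2].
by rewrite /turn ab2 crossMM mulr_ge0 ?sqnorm_ge0.
Qed.

(** The infinite sequence s, z s, z^2 s, ... seen through a window of fixed length
that moves by one place. *)
Definition shift s := if s is a :: s' then rcons s' (z * a) else [::].

Lemma pairwise_shift s : pairwise turn s -> pairwise turn (shift s).
Proof.
case: s => //= a s /andP[/allP as_turn ss]; rewrite pairwise_rcons ss andbT.
by apply/allP => b /as_turn; apply: turn_mul.
Qed.

Lemma pairwise_iter_shift m s :
  pairwise turn s -> pairwise turn (iter m shift s).
Proof. by move=> ss; elim: m => //= m; apply: pairwise_shift. Qed.

Lemma iter_shiftE m s : (m <= size s)%N ->
  iter m shift s = drop m s ++ [seq z * a | a <- take m s].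
Proof.
elim: m => [|m IHm] le_ms; first by rewrite drop0 take0 cats0.
rewrite iterS IHm 1?ltnW // (drop_nth 0 le_ms) (take_nth 0 le_ms) /=.
by rewrite map_rcons rcons_cat.
Qed.

Lemma size_iter_shift m s : size (iter m shift s) = size s.
Proof.
elim: m => //= m <-.
by case: (iter m shift s) => //= a r; rewrite size_rcons.
Qed.

Definition shift_sum s m := \sum_(a <- iter m shift s) a.

(** In the two cross products the mixed terms of [b] and [c] that have the wrong
sign cancel; what remains is a nonnegative combination of the two inequalities
in [turn b c] and of Im z * |b|^2 and Im z * |c|^2. *)
Lemma turn_split b c : turn b c -> turn (b + c) (c + z * b).
Proof.
move=> /andP[bc1 bc2]; rewrite /turn mulrDr.
rewrite !(crossDl, crossDr) !crossvv !cross_mul crossMM.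
have cb : cross c b = - cross b c by rewrite /cross; ring.
have := mulr_ge0 (sqnorm_ge0 z) bc1.
have := mulr_ge0 (ltW z_upper) (sqnorm_ge0 b).
have := mulr_ge0 (ltW z_upper) (sqnorm_ge0 c).
by move=> *; apply/andP; split; lra.
Qed.

(** Since shifting preserves the hypothesis, the list may be replaced by its i-th
shift; then the left sum is b + c and the right one c + z * b. *)
Lemma turn_shift_sum s i j : pairwise turn s -> (i <= j <= size s)%N ->
  turn (shift_sum s i) (shift_sum s j).
Proof.
move=> ss /andP[le_ij le_js]; rewrite /shift_sum -(subnK le_ij) iterD.
move: (pairwise_iter_shift i ss) (size_iter_shift i s).
move: (iter i shift s) (j - i)%N (leq_trans (leq_subr i j) le_js).
move=> r m le_m rr szr.
rewrite iter_shiftE ?szr // -{1}(cat_take_drop m r) !big_cat big_map -mulr_sumr.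
apply/turn_split/turn_sum.
by move: rr; rewrite -{1}(cat_take_drop m r) pairwise_cat => /andP[].
Qed.

Lemma pairwise_shift_sum s (I : seq nat) : pairwise turn s ->
  sorted leq I -> all (fun i => i <= size s)%N I ->
  pairwise turn [seq shift_sum s i | i <- I].
Proof.
move=> ss; rewrite (sorted_pairwise leq_trans) pairwise_map => II leI.
apply: (sub_in_pairwise (P := [pred i | i <= size s]%N)) leI II.
move=> i j _ le_js le_ij; apply: turn_shift_sum => //.
by rewrite le_ij.
Qed.

(** All entries turn left from the first one, a, by less than pi, so none can
compensate a: pairing the sum with z * a leaves at least Im z * |a|^2.  Hence
a = 0, and the tail has sum zero as well. *)
Lemma pairwise_sum_eq0 s : pairwise turn s -> \sum_(a <- s) a = 0 ->
  all (eq_op^~ 0) s.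
Proof.
elim: s => //= a s IHs /andP[/allP as_turn ss]; rewrite big_cons => sum0.
suff a0: a = 0 by rewrite a0 eqxx IHs //; rewrite a0 add0r in sum0.
have: turn a (\sum_(b <- s) b).
  by have := @turn_sum [:: a] s; rewrite big_seq1 allrel1l; apply; apply/allP.
case/andP => _ tail_ge0; have := congr1 (cross^~ (z * a)) sum0.
rewrite /= cross0l crossDl cross_mul => head_tail0.
have head_ge0 := mulr_ge0 (ltW z_upper) (sqnorm_ge0 a).
have : complex.Im z * sqnorm a = 0 by lra.
by move/eqP; rewrite mulf_eq0 (gt_eqF z_upper) sqnorm_eq0 /= => /eqP.
Qed.

Lemma shift_sum_neq0 s i : pairwise turn s -> has (predC1 0) s ->
  shift_sum s i != 0.
Proof.
move=> ss; apply: contraL => /eqP.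
move=> /(pairwise_sum_eq0 (pairwise_iter_shift i ss)).
rewrite -all_predC; elim: i => [|i IHi] /=.
  by apply: sub_all => a /= ->.
move=> h; apply: IHi; case: (iter i shift s) h => //= a r.
have z0 : z != 0 by apply: contraTneq z_upper => ->; rewrite ltxx.
by rewrite all_rcons mulf_eq0 (negPf z0).
Qed.

End ArgumentOrder.

(** * Descents of signed words with a given first letter *)

Section SignedWords.
Implicit Types (S : seq nat) (w : seq int) (k x : int) (n m : nat).

Definition signed S : seq int := [seq m%:Z | m <- S] ++ [seq - m%:Z | m <- S].

(** The argument [n] is the structural one, meant to be [size S]. *)
Fixpoint words n S : seq (seq int) :=
  if n is n'.+1 then [seq k :: w | k <- signed S, w <- words n' (rem `|k|%N S)]
  else [:: [::]].

(** Descents of the word x w; with x = 0 these are the type B descents of w. *)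
Fixpoint des x w : nat :=
  if w is k :: w' then ((k < x)%R + des k w')%N else 0%N.

Lemma size_signed S : size (signed S) = (size S).*2.
Proof. by rewrite size_cat !size_map addnn. Qed.

Lemma mem_signed S k : (k \in signed S) = (`|k|%N \in S).
Proof.
rewrite mem_cat; apply/orP/idP => [[] /mapP[m mS ->]|kS]; rewrite ?abszN //.
by case: (lerP 0 k) => k0; [left|right]; apply/mapP; exists `|k|%N => //; lia.
Qed.

Lemma uniq_signed S : uniq S -> 0%N \notin S -> uniq (signed S).
Proof.
move=> uS S0; rewrite cat_uniq !map_inj_uniq ?uS //= ?andbT; last 2 first.
- by move=> i j /oppr_inj [].
- by move=> i j [].
apply/hasPn => _ /mapP[m mS ->]; apply/mapP => -[i iS mi].
by move: S0; rewrite (_ : 0%N = m) ?mS //; lia.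
Qed.

Lemma perm_signed S S' : perm_eq S S' -> perm_eq (signed S) (signed S').
Proof. by move=> SS'; apply: perm_cat; apply: perm_map. Qed.

Lemma mem_words n S w : size S = n ->
  (w \in words n S) = perm_eq [seq `|k|%N | k <- w] S.
Proof.
elim: n S w => [|n IHn] S w szS.
  move/size0nil: szS => ->; case: w => // k w; rewrite inE /=.
  by apply/esym/negP => /perm_size.
apply/allpairsPdep/idP => [[k [w' [kS w'S ->]]]|].
  rewrite mem_signed in kS.
  rewrite (permPr (perm_to_rem kS)) /= perm_cons -IHn //.
  by rewrite size_rem // szS.
case: w => [/perm_size|k w /=]; first by rewrite szS.
move=> kwS; have kS : `|k|%N \in S by rewrite -(perm_mem kwS) mem_head.
exists k, w; rewrite mem_signed kS; split=> //.
by rewrite IHn ?size_rem ?szS // -(perm_cons `|k|%N) -(permPr (perm_to_rem kS)).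
Qed.

Lemma uniq_words n S : uniq S -> 0%N \notin S -> uniq (words n S).
Proof.
elim: n S => //= n IHn S uS S0; apply: allpairs_uniq_dep.
- exact: uniq_signed.
- by move=> k _; rewrite IHn ?rem_uniq //; apply: contra S0; apply: mem_rem.
- by move=> [k w] [k' w'] _ _ /= [-> ->].
Qed.

End SignedWords.

Section Enumerator.
Variables (R : rcfType) (z : complex R) (ends : pred int).
Hypothesis ends_sgz : forall k, k != 0 -> ends k = ends (sgz k).
Implicit Types (S : seq nat) (w : seq int) (k x : int) (n m : nat).

(** Sum over the words with first letter x, the remaining absolute values forming
S, whose last letter has the sign selected by [ends]; a descent before x is not
counted. *)
Definition wsum x n S : complex R :=
  \sum_(w <- words n S | ends (last x w)) z ^+ des x w.

Lemma wsumS x n S :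
  wsum x n.+1 S = \sum_(k <- signed S) z ^+ (k < x)%R * wsum k n (rem `|k|%N S).
Proof.
rewrite /wsum big_mkcond big_allpairs_dep; apply: eq_bigr => k _.
rewrite mulr_sumr [RHS]big_mkcond; apply: eq_bigr => w _ /=.
by case: ifP => // _; rewrite exprD.
Qed.

(** The letter of rank l among the 2(n+2) signed letters of n+2 absolute values has
[nth 0 (slots n) l] letters below it after removal of itself and its opposite:
the opposite of a positive letter was below it, that of a negative one was not,
so the smallest positive letter and its opposite share the value n+1. *)
Definition slots n : seq nat := iota 0 n.+2 ++ iota n.+1 n.+2.

(** The values of [wsum] for n+1 absolute values in all, listed by increasing first
letter. *)
Fixpoint ranked_values n : seq (complex R) :=
  if n is n'.+1 then [seq shift_sum z (ranked_values n') i | i <- slots n']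
  else [:: (ends (-1))%:R; (ends 1)%:R].

Lemma ranked_valuesS n :
  ranked_values n.+1 = [seq shift_sum z (ranked_values n) i | i <- slots n].
Proof. by []. Qed.

Lemma size_ranked_values n : size (ranked_values n) = n.+1.*2.
Proof. by case: n => [|n] //; rewrite size_map size_cat !size_iota addnn. Qed.

(** Here c is the number of letters below x once x and -x are removed, so that
[c + (0 < x)] is the rank of x among all letters. *)
Lemma nth_slots n c x : x != 0 ->
  (x < 0 -> (c <= n.+1)%N) -> (0 < x -> (n.+1 <= c <= n.+1.*2)%N) ->
  nth 0%N (slots n) (c + (0 < x)%R) = c /\ (c + (0 < x)%R < size (slots n))%N.
Proof.
move=> x0 neg pos; rewrite size_cat !size_iota nth_cat size_iota.
case: (ltrP 0 x) => hx; last first.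
  have {pos}hc: (c <= n.+1)%N by apply: neg; lia.
  by rewrite addn0 ifT ?nth_iota; lia.
have {pos neg} := pos hx.
by move=> hc; rewrite ifF ?nth_iota; lia.
Qed.

Lemma count_signed_bound x S : x != 0 -> 0%N \notin S ->
  (x < 0 -> (count (< x) (signed S) <= size S)%N) /\
  (0 < x -> (size S <= count (< x) (signed S) <= (size S).*2)%N).
Proof.
move=> x0 S0; rewrite count_cat !count_map; split=> hx.
  rewrite [X in (X + _)%N](_ : _ = 0%N) ?count_size //.
  by apply/eqP; rewrite -leqn0 leqNgt -has_count; apply/hasPn => m _ /=; lia.
rewrite [X in (_ + X)%N](_ : _ = size S).
  by rewrite leq_addl -addnn leq_add2r count_size.
by apply/eqP; rewrite -all_count; apply/allP => m _ /=; lia.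
Qed.

(** Removing the first letter k and its opposite leaves different alphabets for
different k; the hypothesis says that only the rank of k matters, which is what
makes one list serve for all of them. *)
Lemma map_wsum n S :
  (forall k S', uniq S' -> 0%N \notin S' -> size S' = n -> k != 0 ->
     `|k|%N \notin S' ->
     wsum k n S' =
       nth 0 (ranked_values n) (count (< k) (signed S') + (0 < k)%R)) ->
  uniq S -> 0%N \notin S -> size S = n.+1 ->
  [seq wsum k n (rem `|k|%N S) | k <- sort <=%O (signed S)] = ranked_values n.
Proof.
move=> wsumE uS S0 szS.
have sorted_lt : sorted <%O (sort <=%O (signed S)).
  by rewrite sort_lt_sorted uniq_signed.
have sz : size (sort <=%O (signed S)) = n.+1.*2.
  by rewrite size_sort size_signed szS.
apply: (@eq_from_nth _ 0) => [|i].
  by rewrite size_map sz size_ranked_values.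
rewrite size_map sz => lt_i.
rewrite (nth_map 0) ?sz //; set k := nth _ _ _.
have kS : `|k|%N \in S by rewrite -mem_signed -(mem_sort <=%O) mem_nth ?sz.
have k0 : k != 0 by apply: contraNneq S0 => k0; rewrite k0 in kS.
rewrite wsumE ?rem_uniq ?size_rem ?szS //; last 2 first.
- by apply: contra S0; apply: mem_rem.
- by rewrite mem_rem_uniqF.
congr nth; rewrite -[RHS](count_lt_nth 0 sorted_lt) ?sz // -/k count_sort.
rewrite (seq.permP (perm_signed (perm_to_rem kS))) !count_cat /=.
have -> : (`|k|%N%:Z < k) = false by move: k k0 {kS} => k; lia.
have -> : (- `|k|%N%:Z < k) = (0 < k) by move: k k0 {kS} => k; lia.
by rewrite add0n addnCA addnC.
Qed.

(** The letters below x come first in the sorted alphabet and are those that create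
a descent, so the recurrence adds up a shifted row. *)
Lemma wsumE n k S : uniq S -> 0%N \notin S -> size S = n -> k != 0 ->
  `|k|%N \notin S ->
  wsum k n S = nth 0 (ranked_values n) (count (< k) (signed S) + (0 < k)%R).
Proof.
elim: n k S => [|n IHn] x S uS S0 szS x0 xS.
  move/size0nil: szS => ->; rewrite /wsum big_mkcond big_seq1 /= ends_sgz //.
  by case: sgzP x0 => //; case: (ends _).
have [] := count_signed_bound x0 S0; rewrite szS => neg pos.
have [slotE slot_lt] := nth_slots x0 neg pos.
rewrite ranked_valuesS (nth_map 0%N) // slotE /shift_sum iter_shiftE; last first.
  by rewrite size_ranked_values -szS -size_signed count_size.
rewrite -(map_wsum IHn uS S0 szS) wsumS -map_drop -map_take.
have le_sorted : sorted <=%O (sort <=%O (signed S)) by exact: sort_le_sorted.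
rewrite -(count_sort <=%O) -sorted_filter_ge // -sorted_filter_lt //.
rewrite -map_comp -(perm_big _ (permEl (perm_sort <=%O _))).
rewrite big_cat !big_map !big_filter /= [RHS]addrC (bigID (< x)) /=.
congr +%R; first by apply: eq_bigr => k ->; rewrite expr1.
apply: eq_big => [k|k /negbTE ->]; [by rewrite leNgt | by rewrite expr0 mul1r].
Qed.

Hypothesis z_upper : 0 < complex.Im z.
Hypothesis ends_xor : ends (-1) = ~~ ends 1.

Lemma sorted_slots n : sorted leq (slots n).
Proof.
rewrite (sorted_pairwise leq_trans) pairwise_cat -!(sorted_pairwise leq_trans).
rewrite !iota_sorted !andbT; apply/allrelP => i j.
by rewrite !mem_iota; lia.
Qed.

Lemma pairwise_ranked_values n : pairwise (turn z) (ranked_values n).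
Proof.
elim: n => [|n IHn].
  by rewrite /= ends_xor; case: (ends 1); rewrite /= ?turn0l ?turn0r.
apply: pairwise_shift_sum => //; first exact: sorted_slots.
apply/allP => i; rewrite size_ranked_values mem_cat !mem_iota; lia.
Qed.

(** The row of index 0 has a zero entry; one step of the recurrence spreads the
nonzero one to all entries. *)
Lemma all_ranked_values_neq0 n : all (predC1 0) (ranked_values n.+1).
Proof.
have nz0 m : has (predC1 0) (ranked_values m) ->
    all (predC1 0) (ranked_values m.+1).
  move=> nz; apply/allP => _ /mapP[i _ ->].
  exact: shift_sum_neq0 (pairwise_ranked_values m) nz.
apply: (nz0); elim: n => [|n IHn].
  by rewrite /= ends_xor; case: (ends 1); rewrite /= ?oner_eq0 ?orbT.
by move: (nz0 _ IHn); rewrite /= => /andP[/= ->].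
Qed.

Lemma wsum_neq0 n k S : uniq S -> 0%N \notin S -> size S = n.+1 -> k != 0 ->
  `|k|%N \notin S -> wsum k n.+1 S != 0.
Proof.
move=> uS S0 szS k0 kS; rewrite wsumE //.
apply: (allP (all_ranked_values_neq0 n)).
have [] := count_signed_bound k0 S0; rewrite szS => neg pos.
have [_ slot_lt] := nth_slots k0 neg pos.
by rewrite mem_nth // size_map.
Qed.

End Enumerator.

(** * Signed permutations in one-line notation *)

Section OneLineNotation.
Variable d : nat.
Implicit Types (s t : {perm pm d}) (k : pm d) (w : seq int) (x y : int).

Definition word s : seq int := [seq sapp s i%:Z | i <- iota 1 d].

Lemma size_word s : size (word s) = d.
Proof. by rewrite size_map size_iota. Qed.

Lemma nth_word s i : (i < d)%N -> nth 0 (word s) i = sapp s i.+1%:Z.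
Proof. by move=> lt_id; rewrite (nth_map 0%N) ?size_iota // nth_iota. Qed.

Lemma sapp_val s k : sapp s (\val k) = \val (s k).
Proof. by rewrite /sapp valK. Qed.

Lemma sapp0 s : sapp s 0 = 0.
Proof. by rewrite /sapp insubN // mem_pm_seq. Qed.

Lemma mem_sapp s x : x \in pm_seq d -> sapp s x \in pm_seq d.
Proof. by move=> xd; rewrite -[x](SubK (pm d) xd) sapp_val; apply: valP. Qed.

Lemma sapp_inj s : {in pm_seq d &, injective (sapp s)}.
Proof.
move=> x y xd yd; rewrite -[x](SubK (pm d) xd) -[y](SubK (pm d) yd) !sapp_val.
by move=> /val_inj /perm_inj ->.
Qed.

Lemma pm_seqN x : (- x \in pm_seq d) = (x \in pm_seq d).
Proof. by rewrite !mem_pm_seq abszN. Qed.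

Lemma sappN s x : s \in B d -> x \in pm_seq d -> sapp s (- x) = - sapp s x.
Proof.
rewrite inE => /forallP sB xd.
by rewrite -[x](SubK (pm d) xd); apply/eqP/sB.
Qed.

Lemma perm_absz_word s : s \in B d ->
  perm_eq [seq `|x|%N | x <- word s] (iota 1 d).
Proof.
move=> sB; have iota_pm i : i \in iota 1 d -> i%:Z \in pm_seq d.
  by rewrite mem_iota mem_pm_seq; lia.
rewrite -map_comp.
have uw : uniq [seq (absz \o (fun i : nat => sapp s i%:Z)) i | i <- iota 1 d].
  rewrite map_inj_in_uniq ?iota_uniq // => i j /= iI jI eq_abs.
  have [] : sapp s i = sapp s j \/ sapp s i = sapp s (- j%:Z).
    by rewrite sappN ?iota_pm //; lia.
    by move/sapp_inj => /(_ (iota_pm _ iI) (iota_pm _ jI)); lia.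
  move/sapp_inj; rewrite pm_seqN => /(_ (iota_pm _ iI) (iota_pm _ jI)).
  by move: iI; rewrite mem_iota; lia.
have sub : {subset [seq (absz \o (fun i : nat => sapp s i%:Z)) i | i <- iota 1 d]
             <= iota 1 d}.
  move=> _ /mapP[i iI ->] /=; have := mem_sapp s (iota_pm i iI).
  by rewrite mem_pm_seq mem_iota; lia.
apply: uniq_perm; rewrite ?iota_uniq //.
by have [] := uniq_min_size uw sub; rewrite ?size_map.
Qed.

Lemma word_inj : {in B d &, injective word}.
Proof.
move=> s t sB tB eq_st; apply/permP => k; apply: val_inj; rewrite -!sapp_val.
have pos i : (0 < i <= d)%N -> sapp s i%:Z = sapp t i%:Z.
  case: i => // i lt_id; rewrite -!nth_word //; last by rewrite eq_st.
have := valP k; rewrite mem_pm_seq => kd.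
case: (lerP 0 (\val k)) => k0.
  by rewrite -[val k]gez0_abs // pos.
rewrite -[val k]opprK -[- val k]lez0_abs 1?ltW //.
by rewrite !sappN ?pos // mem_pm_seq absz_id.
Qed.

(** The preimage sends x to the entry of w at place |x|, negated when x < 0. *)
Lemma word_surj w : perm_eq [seq `|x|%N | x <- w] (iota 1 d) ->
  exists2 s, s \in B d & w = word s.
Proof.
move=> wd; have szw : size w = d.
  by rewrite -(size_map absz) (perm_size wd) size_iota.
pose g x : int := sgz x * nth 0 w `|x|%N.-1.
have nth_abs i : (i < d)%N ->
    nth 0%N [seq `|x|%N | x <- w] i = `|nth 0%R w i|%N.
  by move=> lt_id; rewrite (nth_map 0) ?szw.
have nth_range i : (i < d)%N -> (0 < `|nth 0%R w i| <= d)%N.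
  move=> lt_id; rewrite -nth_abs //.
  suff: nth 0%N [seq `|x|%N | x <- w] i \in iota 1 d by rewrite mem_iota; lia.
  by rewrite -(perm_mem wd) mem_nth // size_map szw.
have abs_g x : x \in pm_seq d -> `|g x|%N = `|nth 0%R w `|x|%N.-1|%N.
  rewrite mem_pm_seq => xd; rewrite abszM.
  suff ->: `|sgz x|%N = 1%N by rewrite mul1n.
  by case: sgzP xd => // ->.
have gd x : x \in pm_seq d -> g x \in pm_seq d.
  move=> xd; rewrite mem_pm_seq abs_g //; apply: nth_range.
  by move: xd; rewrite mem_pm_seq; lia.
have g_inj : {in pm_seq d &, injective g}.
  move=> x y xd yd eq_g; have eq_abs : `|x|%N = `|y|%N.
    have := congr1 absz eq_g; rewrite !abs_g //.
    move: xd yd; rewrite !mem_pm_seq => xd yd.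
    rewrite -!nth_abs; [|lia..] => /eqP.
    rewrite nth_uniq ?size_map ?szw ?(perm_uniq wd) ?iota_uniq //; lia.
  have nz : nth 0 w `|x|%N.-1 != 0.
    rewrite -absz_eq0 -lt0n; move: xd; rewrite mem_pm_seq => xd.
    have /andP[] // : (0 < `|nth 0%R w `|x|%N.-1| <= d)%N.
    by apply: nth_range; lia.
  move: eq_g; rewrite /g -eq_abs => /(mulIf nz) eq_sgz.
  by rewrite [x]intEsg [y]intEsg eq_sgz eq_abs.
pose h k : pm d := Sub (g (\val k)) (gd _ (valP k)).
have h_inj : injective h.
  move=> k k' /(congr1 \val); rewrite !SubK => /g_inj eq_k.
  by apply: val_inj; apply: eq_k; apply: valP.
have sappE x : x \in pm_seq d -> sapp (perm h_inj) x = g x.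
  by move=> xd; rewrite -[x](SubK (pm d) xd) sapp_val permE SubK.
exists (perm h_inj).
  rewrite inE; apply/forallP => k; rewrite !sappE ?pm_seqN ?(valP k) //.
  by rewrite /g sgzN abszN mulNr.
apply: (@eq_from_nth int 0) => [|i]; rewrite ?size_word // szw => lt_id.
rewrite nth_word // sappE ?mem_pm_seq //.
by rewrite /g gtr0_sgz // mul1r.
Qed.

Lemma perm_words :
  perm_eq [seq word s | s <- enum (B d)] (words d (iota 1 d)).
Proof.
apply: uniq_perm.
- rewrite map_inj_in_uniq ?enum_uniq // => s t; rewrite !mem_enum.
  exact: word_inj.
- by apply: uniq_words; rewrite ?iota_uniq // mem_iota.
move=> w; rewrite mem_words ?size_iota //; apply/mapP/idP.
  by case=> s; rewrite mem_enum => sB ->; apply: perm_absz_word.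
by case/word_surj => s sB ->; exists s; rewrite ?mem_enum.
Qed.

Lemma desE x w :
  des x w = (\sum_(i < size w) (nth 0 w i < nth 0 (x :: w) i)%R)%N.
Proof.
elim: w x => [|y w IHw] x; first by rewrite big_ord0.
by rewrite big_ord_recl /= IHw.
Qed.

Lemma desB_word s : desB s = des 0 (word s).
Proof.
rewrite desE size_word /desB -sum1dep_card big_mkcond; apply: eq_bigr => i _ /=.
rewrite nth_word //; case: i => -[|i] lt_id /=; rewrite ?sapp0 //.
by rewrite nth_word 1?ltnW //; case: ifP.
Qed.

End OneLineNotation.

(** * Real-rootedness *)

Lemma sum_signed_perm (R : rcfType) (z : complex R) (ends : pred int)
    (d j : nat) :
  (1 <= j <= d.+1)%N ->
  \sum_(s in B d.+1 | (sapp s 1 == j%:Z) && ends (sapp s d.+1%:Z)) z ^+ desB s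
    = wsum z ends j%:Z d (rem j (iota 1 d.+1)).
Proof.
move=> hj; pose Q w := (nth 0 w 0 == j%:Z) && ends (last 0 w).
rewrite (eq_bigl (fun s => (s \in B d.+1) && Q (word s))); last first.
  move=> s; rewrite /Q nth_word // (last_nth 0) size_word.
  by rewrite -[nth 0 (0 :: _) _]/(nth 0 (word s) d) nth_word.
under eq_bigr do rewrite desB_word.
rewrite -big_enum_cond -(big_map (@word d.+1) Q (fun w => z ^+ des 0 w)).
rewrite (perm_big _ (perm_words _)) big_mkcond big_allpairs_dep.
have uS : uniq (signed (iota 1 d.+1)).
  by rewrite uniq_signed ?iota_uniq ?mem_iota.
have jS : j%:Z \in signed (iota 1 d.+1) by rewrite mem_signed mem_iota.
move: (iota 1 d.+1) uS jS => S uS jS.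
rewrite (bigD1_seq j%:Z) //= [X in _ + X]big1 ?addr0 => [|k /negbTE jk].
  rewrite /wsum [RHS]big_mkcond; apply: eq_bigr => w _.
  by rewrite /Q /= eqxx.
by apply: big1 => w _; rewrite /Q /= jk.
Qed.

(** Nonreal roots of a real polynomial come in conjugate pairs. *)
Lemma real_rooted_upper (R : realType) (p : {poly R}) :
  (forall z : complex R, 0 < complex.Im z ->
     ~~ root (map_poly (real_complex R) p) z) ->
  real_rooted p.
Proof.
move=> no_upper; right=> z rz; exists (complex.Re z).
suff: complex.Im z = 0 by case: z rz => x y _ /= ->.
have rzc : root (map_poly (real_complex R) p) (conjc z).
  rewrite -complex_root_conj -map_poly_comp.
  by rewrite (eq_map_poly (g := real_complex R)) // => x; rewrite /= oppr0.
case: (ltrgtP 0 (complex.Im z)) => // [|neg]; first by move/no_upper/negP.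
have : 0 < complex.Im (conjc z).
  by case: z neg {rz rzc} => x y /=; rewrite oppr_gt0.
by move/no_upper; rewrite rzc.
Qed.

Lemma root_sumXn (R : realType) (I : finType) (P : pred I) (e : I -> nat)
    (z : complex R) :
  root (map_poly (real_complex R) (\sum_(i | P i) 'X^(e i))) z
    = (\sum_(i | P i) z ^+ e i == 0).
Proof.
rewrite rootE raddf_sum horner_sum; congr (_ == 0).
by apply: eq_bigr => i _; rewrite /= map_polyXn hornerXn.
Qed.


Theorem theorem4p9 (R : realType) (d j : nat) (hd : (1 <= d)%N)
    (hj : (1 <= j <= d)%N) :
  real_rooted (Bplus R d (Posz j)) /\ real_rooted (Bminus R d (Posz j)).
Proof.
case: d hd hj => // d _ hj.
have rr (ends : pred int) : (forall k, k != 0 -> ends k = ends (sgz k)) ->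
    ends (-1) = ~~ ends 1 ->
    real_rooted (\sum_(s in B d.+1 | (sapp s 1 == j%:Z) &&
                                     ends (sapp s d.+1%:Z))
                   'X^(desB s) : {poly R}).
  (* For d = 1 the first letter is also the last one: the polynomial is 0 or 1. *)
  case: d hj => [|d] hj ends_sgz ends_xor.
    have {hj} -> : j = 1%N by lia.
    case ends1: (ends 1); last first.
      by left; apply: big1 => s /andP[_ /andP[/eqP ->]]; rewrite ends1.
    apply: real_rooted_upper => z _; rewrite root_sumXn sum_signed_perm //.
    by rewrite /wsum /= big_mkcond big_seq1 /= ends1 expr0 oner_eq0.
  apply: real_rooted_upper => z z_upper; rewrite root_sumXn sum_signed_perm //.
  have jI : j \in iota 1 d.+2 by rewrite mem_iota.
  have uI := iota_uniq 1 d.+2.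
  apply: wsum_neq0; rewrite ?rem_uniq ?size_rem ?size_iota //.
  - by apply/negP => /mem_rem; rewrite mem_iota.
  - lia.
  - by rewrite mem_rem_uniqF.
split.
  by apply: (rr (fun k => 0 < k)) => // k _; rewrite sgz_gt0.
by apply: (rr (fun k => k < 0)) => // k _; rewrite sgz_lt0.
Qed.
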